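(* Let $\mathcal{F}=(W,\preccurlyeq,V_{\mathcal{F}})$ be a finite poset model and $\mathcal{F}_{\min}=(W_{\min},R_{\min},V_{\min})$ its quotient Kripke model modulo $\equiv_\eta$. Then for each $w\in W$ and each $\mathrm{SLCS}_\eta$ formula $\Phi$: $\mathcal{F},w\models\Phi$ if and only if $\mathcal{F}_{\min},[w]_{\equiv_\eta}\models\Phi$.
   Context: A Kripke model is $(W,R,V)$ with $R\subseteq W\times W$ and $V:PL\to2^W$; a finite poset model is one with $W$ finite and $R=\preccurlyeq$ a partial order. In a Kripke model, a $\pm$-path of length $\ell\ge2$ is $\pi:\{0,\dots,\ell\}\to W$ with $R(\pi(i),\pi(i+1))$ or $R(\pi(i+1),\pi(i))$ for each $i<\ell$, and $R(\pi(0),\pi(1))$, $R(\pi(\ell),\pi(\ell-1))$. $\mathrm{SLCS}_\eta$: $\Phi::=p\mid\neg\Phi\mid\Phi_1\wedge\Phi_2\mid\eta(\Phi_1,\Phi_2)$, with $w\models p$ iff $w\in V(p)$, Boolean connectives standard, $w\models\eta(\Phi_1,\Phi_2)$ iff some $\pm$-path $\pi$ of length $\ell$ with $\pi(0)=w$ has $\pi(\ell)\models\Phi_2$ and $\pi(i)\models\Phi_1$ for all $i<\ell$. In $\mathcal{F}$, $w\equiv_\eta w'$ iff $w,w'$ satisfy the same formulas. $\mathcal{F}_{\min}$: $W_{\min}=W/{\equiv_\eta}$; $R_{\min}([w_1],[w_2])$ iff $w_1'\preccurlyeq w_2'$ for some $w_1'\equiv_\eta w_1$, $w_2'\equiv_\eta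 w_2$; $V_{\min}(p)=\{[w]: w'\in V_{\mathcal{F}}(p)\text{ for some }w'\equiv_\eta w\}$. *)

(* Defs.v *)
From HB Require Import structures.
From mathcomp Require Import all_boot all_order.
From mathcomp Require Import boolp classical_sets.

Set Implicit Arguments.
Unset Strict Implicit.
Unset Printing Implicit Defensive.

Import Order.TTheory.
Local Open Scope order_scope.
Local Open Scope quotient_scope.
Local Open Scope classical_set_scope.

Record kripke (PL : Type) := Kripke {
  world :> Type;
  acc : world -> world -> Prop;
  val_pl : PL -> set world }.

(* A path of length l is a map on {0, ..., l} = 'I_l.+1; [inord i] is the
   element of value i, and is only used below for i <= l. *)
Definition pm_path (W : Type) (R : W -> W -> Prop) (l : nat)
    (pi : 'I_l.+1 -> W) : Prop :=
  [/\ (2 <= l)%N,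
      forall i : nat, (i < l)%N ->
        R (pi (inord i)) (pi (inord i.+1)) \/ R (pi (inord i.+1)) (pi (inord i)),
      R (pi (inord 0)) (pi (inord 1))
    & R (pi (inord l)) (pi (inord l.-1))].

Inductive form (PL : Type) :=
  | Atom of PL
  | Neg of form PL
  | Conj of form PL & form PL
  | Eta of form PL & form PL.

Fixpoint sat (PL : Type) (M : kripke PL) (phi : form PL) (w : M) : Prop :=
  match phi with
  | Atom p => val_pl p w
  | Neg phi1 => ~ sat phi1 w
  | Conj phi1 phi2 => sat phi1 w /\ sat phi2 w
  | Eta phi1 phi2 =>
      exists (l : nat) (pi : 'I_l.+1 -> M),
        [/\ pm_path (@acc PL M) pi,
            pi (inord 0) = w,
            sat phi2 (pi (inord l))
          & forall i : nat, (i < l)%N -> sat phi1 (pi (inord i))]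
  end.

Definition eta_eq (PL : Type) (M : kripke PL) (w w' : M) : Prop :=
  forall phi : form PL, sat phi w <-> sat phi w'.

Definition poset_model (PL : Type) (d : Order.disp_t) (W : finPOrderType d)
    (V : PL -> set W) : kripke PL :=
  @Kripke PL W (fun x y => x <= y) V.

Section Quotient.
Variables (PL : Type) (d : Order.disp_t) (W : finPOrderType d).
Variable V : PL -> set W.

Definition eta_rel : rel W :=
  fun w w' => `[< @eta_eq PL (poset_model V) w w' >].

Lemma eta_rel_equiv : equiv_class_of eta_rel.
Proof.
split=> [w|w w'|w' w w''].
- by apply/asboolP.
- by apply: asbool_equiv_eq; split=> h phi; apply: iff_sym; apply: h.
- move=> /asboolP h /asboolP h'; apply/asboolP => phi.
  exact: iff_trans (h phi) (h' phi).
Qed.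

Canonical eta_equiv_rel := EquivRelPack eta_rel_equiv.

Definition Wmin : Type := {eq_quot eta_equiv_rel}.

Definition eta_class (w : W) : Wmin := \pi_({eq_quot eta_equiv_rel}) w.

Lemma eta_classP (w w' : W) :
  eta_class w = eta_class w' <-> @eta_eq PL (poset_model V) w w'.
Proof.
split=> [/eqmodP/asboolP //|h].
by apply/eqmodP/asboolP.
Qed.

(* [eta_class w' = eta_class w] means [eta_eq w' w]; see RminE and VminE for
   the relation and the valuation in terms of representatives. *)
Definition Rmin (c1 c2 : Wmin) : Prop :=
  exists w1 w2 : W, [/\ eta_class w1 = c1, eta_class w2 = c2 & w1 <= w2].

Definition Vmin (p : PL) : set Wmin :=
  [set c | exists2 w : W, eta_class w = c & V p w].

Lemma RminE (w1 w2 : W) :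
  Rmin (eta_class w1) (eta_class w2) <->
  exists w1' w2' : W, [/\ @eta_eq PL (poset_model V) w1' w1,
    @eta_eq PL (poset_model V) w2' w2 & w1' <= w2'].
Proof.
by split=> -[u1 [u2 [/eta_classP h1 /eta_classP h2 le_u]]]; exists u1, u2.
Qed.

Lemma VminE (p : PL) (w : W) :
  Vmin p (eta_class w) <->
  exists2 w' : W, @eta_eq PL (poset_model V) w' w & V p w'.
Proof. by split=> -[u /eta_classP h Vu]; exists u. Qed.

Definition min_model : kripke PL := @Kripke PL Wmin Rmin Vmin.

End Quotient.

(* Main.v *)
Require Import Defs.
From HB Require Import structures.
From mathcomp Require Import all_boot all_order.
From mathcomp Require Import boolp classical_sets.

(** The truth of eta(a, b) is a class invariant, so a path of the quotient
    witnessing eta(a, b) need not be lifted as a whole: going backwards along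
    it, eta(a, b) propagates from each class to the previous one.  Each step of
    the quotient path is witnessed by a step of the poset between two
    representatives u, v; if v satisfies eta(a, b) and u satisfies a, then
    prefixing u, u to a path from v gives one from u, whatever the direction of
    the step, because the order is reflexive. *)

(** Indexing paths by [nat] turns prefixing and shifting into case analysis, free of [inord]; values
    beyond [l] are irrelevant. *)
Lemma sat_EtaP (PL : Type) (M : kripke PL) (a b : form PL) (w : M) :
  sat (Eta a b) w <->
  exists (l : nat) (f : nat -> M),
    [/\ (2 <= l)%N,
        forall i, (i < l)%N -> acc (f i) (f i.+1) \/ acc (f i.+1) (f i),
        acc (f 0) (f 1) & acc (f l) (f l.-1)] /\
    [/\ f 0 = w, sat b (f l) & forall i, (i < l)%N -> sat a (f i)].
Proof.
split.
- move=> [l [p [[l2 st up dn] p0 pl pa]]].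
  by exists l, (fun i => p (inord i)).
- move=> [l [f [[l2 st up dn] [f0 fl fa]]]].
  have K i : (i <= l)%N -> (inord i : 'I_l.+1) = i :> nat.
    by move=> le_il; rewrite inordK.
  exists l, (fun i : 'I_l.+1 => f i); split; first split=> //.
  + by move=> i lt_il; rewrite !K ?(ltnW lt_il) //; apply: st.
  + by rewrite !K // ltnW.
  + by rewrite !K // leq_pred.
  + by rewrite K.
  + by rewrite K.
  + by move=> i lt_il; rewrite K ?(ltnW lt_il) //; apply: fa.
Qed.

(** Base case of the backward induction: [v], [v], [u] is a path of the least allowed length, its
    first step being reflexivity at [v]. *)
Lemma sat_Eta_down (PL : Type) (M : kripke PL) (a b : form PL) (u v : M) :
  acc v v -> acc u v -> sat a v -> sat b u -> sat (Eta a b) v.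
Proof.
move=> vv uv av bu; apply/sat_EtaP.
exists 2, (fun i => if (i < 2)%N then v else u); do 2!split=> //.
- by case=> [|[|]] //=; [left|right].
- by move=> i ->.
Qed.

Lemma sat_Eta_step (PL : Type) (M : kripke PL) (a b : form PL) (u v : M) :
  acc u u -> acc u v \/ acc v u -> sat a u ->
  sat (Eta a b) v -> sat (Eta a b) u.
Proof.
move=> uu uv au /sat_EtaP [l [f [[l2 st _ dn] [f0 fl fa]]]]; apply/sat_EtaP.
exists l.+2, (fun i => if i is j.+2 then f j else u); do 2!split=> //.
- case=> [|[|i]] //=; first by left.
  + by rewrite f0.
  + by rewrite !ltnS; apply: st.
(* [l] is positive, so position [l.+1] lies in the shifted part and the last step is that of [f]. *)
- by case: l l2 dn {st fl fa}.
- by case=> [|[|i]] //=; rewrite !ltnS; apply: fa.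
Qed.

Theorem theorem5p11 (PL : Type) (d : Order.disp_t) (W : finPOrderType d)
    (V : PL -> set W) (w : W) (Phi : form PL) :
  @sat PL (poset_model V) Phi w <-> @sat PL (min_model V) Phi (eta_class V w).
Proof.
elim: Phi w => [p|a IHa|a IHa b IHb|a IHa b IHb] w.
- split=> [Vw|/VminE [w' ww' Vw']]; first by exists w.
  exact/(ww' (Atom p)).
- by split=> nsat /IHa.
- by split=> -[/IHa ? /IHb].
split=> /sat_EtaP [l [f [[l2 st up dn] [f0 fl fa]]]].
- have Rcls x y : (x <= y)%O -> Rmin (eta_class V x) (eta_class V y).
    by move=> le_xy; exists x, y.
  apply/sat_EtaP; exists l, (fun i => eta_class V (f i)).
  split; split; rewrite ?f0 //.
  + by move=> i /st [] /Rcls; [left|right].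
  + by rewrite -f0; apply: Rcls.
  + exact: Rcls.
  + exact/IHb.
  + by move=> i /fa /IHa.
(* [k] counts backwards from [l.-1], the last position where [a] is required; [k = l.-1] reaches the
   class of [w]. *)
- suff back k x : (k < l)%N -> eta_class V x = f (l.-1 - k)%N ->
      @sat PL (poset_model V) (Eta a b) x.
    by apply: (back l.-1); rewrite ?subnn ?f0 // prednK // ltnW.
  have lt_pred i : (l.-1 - i < l)%N.
    by case: l l2 {st up dn fl fa} => // l _; rewrite ltnS leq_subr.
  elim: k x => [|k IHk] x lt_kl.
  + rewrite subn0 => xf; case: dn => u [v [uf vf le_uv]].
    (* The final edge is witnessed at [v], possibly distinct from [x]; being a formula, [Eta a b]
       transfers from [v] to [x]. *)
    have /eta_classP xv : eta_class V x = eta_class V v by rewrite xf vf.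
    apply/xv; apply: (@sat_Eta_down _ (poset_model V) a b u v) => //=.
    * by apply/IHa; rewrite vf -[l.-1]subn0; apply: fa.
    * by apply/IHb; rewrite uf.
  + have next : (l.-1 - k)%N = (l.-1 - k.+1).+1.
      by rewrite subnSK // -ltnS prednK // ltnW.
    move=> xf.
    (* [x] itself may not be comparable to any point of the next class, but some equivalent [u]
       is. *)
    have [u [v [xu uv vf]]] : exists u v : W,
        [/\ @eta_eq PL (poset_model V) x u, (u <= v)%O \/ (v <= u)%O
          & eta_class V v = f (l.-1 - k)%N].
      rewrite next; have /st := lt_pred k.+1.
      case=> -[y [z [yf zf le_yz]]]; [exists y, z | exists z, y]; split=> //;
        by [apply/eta_classP; rewrite xf ?yf ?zf | left | right].
    apply/xu; apply: (@sat_Eta_step _ (poset_model V) a b u v) => //=.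
    * apply/xu/IHa; rewrite xf; exact: fa.
    * by apply: IHk vf; apply: ltnW.
Qed.
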